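(* Let $\mathcal F$ be a maximal commuting family of $\mathbf i$-boxes in $[a,b]$. Then there exists an admissible chain $\mathfrak C=(\mathfrak c_k)_{1\le k\le l}$ of $\mathbf i$-boxes with extent $[a,b]$ such that $\mathcal F=\{\mathfrak c_k : 1\le k\le l\}$.
   Context: Let $I$ be a set, $S\subset\mathbb Z$ an interval, $\mathbf i=(i_k)_{k\in S}$ a sequence in $I$, and $[a,b]=\{k\in\mathbb Z:a\le k\le b\}\subset S$ a finite nonempty interval. For $s\in S$, $j\in I$: $s_+=\min(\{t\in S:t>s,i_t=i_s\}\cup\{\infty\})$, $s_-=\max(\{t\in S:t<s,i_t=i_s\}\cup\{-\infty\})$, $s(j)^+=\min(\{t\in S:t\ge s,i_t=j\}\cup\{\infty\})$, $s(j)^-=\max(\{t\in S:t\le s,i_t=j\}\cup\{-\infty\})$. An $\mathbf i$-box is a finite interval $[x,y]\subset S$ with $i_x=i_y$ (its color). For an interval $[x,y]$: $[x,y\}=[x,y(i_x)^-]$, $\{x,y]=[x(i_y)^+,y]$. Two $\mathbf i$-boxes $[x_1,y_1],[x_2,y_2]$ commute if $(x_1)_-<x_2\le y_2<(y_1)_+$ or $(x_2)_-<x_1\le y_1<(y_2)_+$. A commuting family of $\mathbf i$-boxes in $[a,b]$ is a set of pairwise commuting $\mathbf i$-boxes contained in $[a,b]$; it is maximal if it is maximal among such families. An admissible chain of $\mathbf i$-boxes is a sequence $(\mathfrak c_k=[x_k,y_k])_{1\le k\le l}$ of $\mathbf i$-boxes ($l\ge1$) such that for each $k\in[1,l]$ the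 envelope $\widetilde{\mathfrak c}_k=[\tilde x_k,\tilde y_k]:=\bigcup_{1\le j\le k}[x_j,y_j]$ is an interval with $k$ elements, and either $[x_k,y_k]=[\tilde x_k,\tilde y_k\}$ or $[x_k,y_k]=\{\tilde x_k,\tilde y_k]$. Its extent is $\widetilde{\mathfrak c}_l$ (so extent $[a,b]$ forces $l=b-a+1$). *)

(* Defs.v *)
From HB Require Import structures.
From mathcomp Require Import all_boot all_order all_algebra.
From mathcomp Require Import mathcomp_extra boolp classical_sets cardinality.
From mathcomp Require Import set_interval constructive_ereal num_normedtype.

Set Implicit Arguments.
Unset Strict Implicit.
Unset Printing Implicit Defensive.
Import Order.TTheory GRing.Theory Num.Theory.
Local Open Scope classical_set_scope.
Local Open Scope ring_scope.

(* [\bar int] is Z extended with -oo and +oo. The default values of [xget]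
   play no role below: the sets of [next], [prev], [first_ge], [last_le] do have
   a least, resp. greatest, element, as they contain +oo, resp. -oo, and their
   finite elements are bounded below, resp. above. *)
Definition emin (A : set (\bar int)) : \bar int := xget +oo%E (A `&` lbound A).
Definition emax (A : set (\bar int)) : \bar int := xget -oo%E (A `&` ubound A).

(* A sequence indexed by S is given as a total function [i : int -> I], of
   which only the values on S are ever used. *)

(* s_+ *)
Definition next (I : Type) (S : set int) (i : int -> I) (s : int) : \bar int :=
  emin ([set t%:E%E | t in [set t | [/\ S t, s < t & i t = i s]]]
        `|` [set +oo%E]).

(* s_- *)
Definition prev (I : Type) (S : set int) (i : int -> I) (s : int) : \bar int :=
  emax ([set t%:E%E | t in [set t | [/\ S t, t < s & i t = i s]]]
        `|` [set -oo%E]).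

(* s(j)^+ *)
Definition first_ge (I : Type) (S : set int) (i : int -> I) (s : int) (j : I) :
    \bar int :=
  emin ([set t%:E%E | t in [set t | [/\ S t, s <= t & i t = j]]]
        `|` [set +oo%E]).

(* s(j)^- *)
Definition last_le (I : Type) (S : set int) (i : int -> I) (s : int) (j : I) :
    \bar int :=
  emax ([set t%:E%E | t in [set t | [/\ S t, t <= s & i t = j]]]
        `|` [set -oo%E]).

(* A nonempty interval [x, y] of Z is encoded by the pair (x, y) with x <= y. *)
Definition seg (c : int * int) : set int := [set` `[c.1, c.2]].

Definition ibox (I : Type) (S : set int) (i : int -> I) (c : int * int) : Prop :=
  [/\ c.1 <= c.2, seg c `<=` S & i c.1 = i c.2].

(* [x, y} *)
Definition seg_rtrunc (I : Type) (S : set int) (i : int -> I) (x y : int) :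
    set int :=
  [set z | (x%:E <= z%:E <= last_le S i y (i x))%E].

(* {x, y] *)
Definition seg_ltrunc (I : Type) (S : set int) (i : int -> I) (x y : int) :
    set int :=
  [set z | (first_ge S i x (i y) <= z%:E <= y%:E)%E].

Definition commute (I : Type) (S : set int) (i : int -> I) (c d : int * int) :
    Prop :=
  [/\ (prev S i c.1 < d.1%:E)%E, d.1 <= d.2 & (d.2%:E < next S i c.2)%E]
  \/ [/\ (prev S i d.1 < c.1%:E)%E, c.1 <= c.2 & (c.2%:E < next S i d.2)%E].

Definition commuting_family (I : Type) (S : set int) (i : int -> I) (a b : int)
    (F : set (int * int)) : Prop :=
  (forall c, F c -> ibox S i c /\ seg c `<=` seg (a, b)) /\
  (forall c d, F c -> F d -> c <> d -> commute S i c d).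

Definition maximal_commuting_family (I : Type) (S : set int) (i : int -> I)
    (a b : int) (F : set (int * int)) : Prop :=
  commuting_family S i a b F /\
  (forall G, commuting_family S i a b G -> F `<=` G -> G = F).

(* Chains are indexed from 1; the values of [c] outside 1..l are irrelevant. *)
Definition envelope (c : nat -> int * int) (k : nat) : set int :=
  \bigcup_(j in [set j | (1 <= j <= k)%N]) seg (c j).

Definition admissible_chain (I : Type) (S : set int) (i : int -> I) (l : nat)
    (c : nat -> int * int) : Prop :=
  (1 <= l)%N /\
  forall k, (1 <= k <= l)%N ->
    ibox S i (c k) /\
    exists x y : int,
      [/\ envelope c k = seg (x, y),
          (envelope c k #= `I_k)%card &
          seg (c k) = seg_rtrunc S i x y \/ seg (c k) = seg_ltrunc S i x y].

(* Main.v *)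
Require Import Defs.
From mathcomp Require Import all_boot all_order all_algebra.
From mathcomp Require Import mathcomp_extra boolp classical_sets cardinality.
From mathcomp Require Import set_interval constructive_ereal num_normedtype.
From mathcomp Require Import zify.
Import Order.TTheory GRing.Theory Num.Theory.
Local Open Scope classical_set_scope.
Local Open Scope ring_scope.

Set Implicit Arguments.
Unset Strict Implicit.

(** The proof removes the last box of the chain and goes by induction on the
    number of elements of [a, b].

    Write [a, y] for [a, b}, so that y is the last index of [a, b] with the
    color of a.  Then a_- < a and b < y_+, so this box commutes with every box
    contained in [a, b] ([rtrunc_universal]); the same holds for {a, b] = [x, b]
    ([ltrunc_universal]).  By maximality both belong to F ([universal_mem]).

    Another member of F that starts at a ends before y, and another member that
    ends at b starts after x.  Two such boxes are distinct, as the first ends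
    before b, and cannot commute: if [a, y'] and
    [x', b] did, one of y'_+ > b and x'_- < a would hold, whereas
    y'_+ <= y <= b and x'_- >= x >= a.  Hence [a, b} is the only
    member of F containing a, or {a, b] is the only one containing b
    ([unique_end_box]).  Removing it leaves a commuting family in [a + 1, b],
    resp. [a, b - 1], which is again maximal because the removed box commutes
    with everything and can be put back ([maximal_setD1]).  A chain for the
    smaller interval, extended by the removed box, is a chain for [a, b]. *)

(** * Integer sets and their extrema *)

Lemma int_max (P : set int) (b : int) :
  (exists t, P t) -> (forall t, P t -> t <= b) ->
  exists2 m, P m & forall t, P t -> t <= m.
Proof.
move=> [t0 Pt0] Pb.
pose Q n := `[< P (t0 + n%:Z) >].
have Q0 : exists n, Q n by exists 0%N; apply/asboolP; rewrite addr0.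
have Qb n : Q n -> (n <= `|b - t0|)%N by move/asboolP/Pb; lia.
case: (ex_maxnP Q0 Qb) => m /asboolP Pm maxm.
exists (t0 + m%:Z) => // t Pt.
case: (leP t t0) => [|lt0]; first by lia.
have /maxm : Q `|t - t0|%N.
  by apply/asboolP; have -> : t0 + `|t - t0|%N%:Z = t by lia.
by lia.
Qed.

Lemma int_min (P : set int) (b : int) :
  (exists t, P t) -> (forall t, P t -> b <= t) ->
  exists2 m, P m & forall t, P t -> m <= t.
Proof.
move=> [t0 Pt0] Pb.
have [||m Pm maxm] := @int_max [set t | P (- t)] (- b).
- by exists (- t0); rewrite /= opprK.
- by move=> t /Pb; lia.
- exists (- m) => // t Pt.
  have /maxm : P (- - t) by rewrite opprK.
  by lia.
Qed.

Lemma emax_eq (A : set (\bar int)) (m : \bar int) :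
  A m -> ubound A m -> emax A = m.
Proof.
move=> Am Um; apply: xget_unique => // z [Az Uz].
by apply/eqP; rewrite eq_le Um // Uz.
Qed.

Lemma emin_eq (A : set (\bar int)) (m : \bar int) :
  A m -> lbound A m -> emin A = m.
Proof.
move=> Am Um; apply: xget_unique => // z [Az Uz].
by apply/eqP; rewrite eq_le Um // Uz.
Qed.

Lemma emax_fin (P : set int) (m : int) :
  P m -> (forall t, P t -> t <= m) ->
  emax ([set t%:E%E | t in P] `|` [set -oo%E]) = m%:E%E.
Proof.
move=> Pm maxm; apply: emax_eq; first by left; exists m.
by move=> _ [[t Pt <-]|->]; rewrite ?lee_fin ?leNye // maxm.
Qed.

Lemma emin_fin (P : set int) (m : int) :
  P m -> (forall t, P t -> m <= t) ->
  emin ([set t%:E%E | t in P] `|` [set +oo%E]) = m%:E%E.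
Proof.
move=> Pm minm; apply: emin_eq; first by left; exists m.
by move=> _ [[t Pt <-]|->]; rewrite ?lee_fin ?leey // minm.
Qed.

Lemma emax_lt (P : set int) (b d : int) :
  (forall t, P t -> t <= b) ->
  (emax ([set t%:E%E | t in P] `|` [set -oo%E]) < d%:E)%E
  <-> forall t, P t -> t < d.
Proof.
move=> Pb; have [exP|nP] := pselect (exists t, P t).
  have [m Pm maxm] := int_max exP Pb.
  rewrite (emax_fin Pm maxm) lte_fin; split=> [md t /maxm|]; last exact.
  by move=> /le_lt_trans; apply.
have -> : emax ([set t%:E%E | t in P] `|` [set -oo%E]) = -oo%E.
  apply: emax_eq; first by right.
  by move=> _ [[t Pt <-]|->] //; case: nP; exists t.
by split=> [_ t Pt|_]; [case: nP; exists t | rewrite ltNyr].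
Qed.

Lemma emin_gt (P : set int) (b d : int) :
  (forall t, P t -> b <= t) ->
  (d%:E < emin ([set t%:E%E | t in P] `|` [set +oo%E]))%E
  <-> forall t, P t -> d < t.
Proof.
move=> Pb; have [exP|nP] := pselect (exists t, P t).
  have [m Pm minm] := int_min exP Pb.
  rewrite (emin_fin Pm minm) lte_fin; split=> [md t /minm|]; last exact.
  by move=> /(lt_le_trans md).
have -> : emin ([set t%:E%E | t in P] `|` [set +oo%E]) = +oo%E.
  apply: emin_eq; first by right.
  by move=> _ [[t Pt <-]|->] //; case: nP; exists t.
by split=> [_ t Pt|_]; [case: nP; exists t | rewrite ltry].
Qed.

(** * Segments and commutation *)

Lemma segE (c : int * int) (z : int) : seg c z = (c.1 <= z <= c.2) :> Prop.
Proof. by rewrite /seg /= in_itv. Qed.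

Lemma subset_seg (x y a b : int) :
  x <= y -> seg (x, y) `<=` seg (a, b) <-> a <= x /\ y <= b.
Proof.
move=> xy; split=> [xyab|[ax yb] z]; last by rewrite !segE /=; lia.
by have := xyab x; have := xyab y; rewrite !segE /=; lia.
Qed.

Lemma seg_card (x : int) (n : nat) : (seg (x, x + n%:Z - 1)%R #= `I_n)%card.
Proof.
apply/card_set_bijP; exists (fun z => `|z - x|%N); split.
- by move=> z; rewrite segE /=; lia.
- by move=> z t; rewrite !inE !segE /=; lia.
- move=> k /= kn; exists (x + k%:Z); last by lia.
  by rewrite segE /=; lia.
Qed.

(** Each of the two clauses of [commute c d], stated with quantifiers over
    indices instead of the extended integers [prev] and [next]. *)
Definition surrounds {I : Type} (S : set int) (i : int -> I) (c d : int * int) :=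
  [/\ forall t, S t -> t < c.1 -> i t = i c.1 -> t < d.1,
      d.1 <= d.2
    & forall t, S t -> c.2 < t -> i t = i c.2 -> d.2 < t].

Section Boxes.
Variables (I : Type) (S : set int) (i : int -> I).
Implicit Types (a b x y : int) (c d e : int * int) (F G : set (int * int)).

Lemma surroundsE c d :
  [/\ (Defs.prev S i c.1 < d.1%:E)%E, d.1 <= d.2 & (d.2%:E < Defs.next S i c.2)%E]
  <-> surrounds S i c d.
Proof.
have pE : (Defs.prev S i c.1 < d.1%:E)%E <->
    forall t, [/\ S t, t < c.1 & i t = i c.1] -> t < d.1.
  by apply: (@emax_lt _ c.1) => t [_ /ltW].
have nE : (d.2%:E < Defs.next S i c.2)%E <->
    forall t, [/\ S t, c.2 < t & i t = i c.2] -> d.2 < t.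
  by apply: (@emin_gt _ c.2) => t [_ /ltW].
split=> -[].
  by move=> /pE p ? /nE n; split=> // t *; [apply: p | apply: n].
by move=> p ? n; split=> //; [apply/pE => t [] | apply/nE => t []]; auto.
Qed.

Lemma commuteE c d : Defs.commute S i c d <-> surrounds S i c d \/ surrounds S i d c.
Proof. by rewrite /Defs.commute !surroundsE. Qed.

Lemma commute_sym c d : Defs.commute S i c d -> Defs.commute S i d c.
Proof. by case; [right|left]. Qed.

(** * Boxes that commute with every box of the segment *)

Definition universal_box a b e :=
  [/\ ibox S i e, seg e `<=` seg (a, b)
    & forall d, d.1 <= d.2 -> seg d `<=` seg (a, b) -> Defs.commute S i e d].

Lemma commuting_setU1 a b e F :
  universal_box a b e -> commuting_family S i a b F ->
  commuting_family S i a b (e |` F).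
Proof.
move=> [ibe eab ecomm] [Fab Fcomm]; split=> [c [->|/Fab]//|c d].
have eF d' : F d' -> Defs.commute S i e d' by move=> /Fab[[? _ _]]; exact: ecomm.
move=> [->|Fc] [->|Fd] // cd; [exact: eF | exact/commute_sym/eF |exact: Fcomm].
Qed.

Lemma universal_mem a b e F :
  universal_box a b e -> maximal_commuting_family S i a b F -> F e.
Proof.
move=> ue [Fcf maxF].
by rewrite -(maxF _ (commuting_setU1 ue Fcf)) ?/setU1; [left | right].
Qed.

(** A commuting family of the smaller segment extending F minus e becomes,
    once e is put back, a commuting family of [a, b] extending F. *)
Lemma maximal_setD1 a b a' b' e F :
  a <= a' -> b' <= b -> universal_box a b e -> ~ seg e `<=` seg (a', b') ->
  maximal_commuting_family S i a b F ->
  (forall d, F d -> d <> e -> seg d `<=` seg (a', b')) ->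
  maximal_commuting_family S i a' b' (F `\ e).
Proof.
move=> aa' bb' ue enab' mF Fab'; have [[Fab Fcomm] maxF] := mF.
have sub : seg (a', b') `<=` seg (a, b) by move=> z; rewrite !segE /=; lia.
split=> [|G [Gab' Gcomm] FG].
  split=> [c [Fc ce]|c d [Fc _] [Fd _]]; last exact: Fcomm.
  by split; [exact: (Fab _ Fc).1 | exact: Fab'].
have Gcf : commuting_family S i a b G.
  by split=> // c /Gab'[? cab']; split=> //; exact: subset_trans sub.
have GF : e |` G = F.
  apply: maxF; first exact: commuting_setU1.
  by move=> c Fc; have [->|ce] := pselect (c = e); [left | right; exact: FG].
apply/seteqP; split=> // c Gc; split; first by rewrite -GF; right.
by move=> /= ce; apply: enab'; rewrite -ce; exact: (Gab' _ Gc).2.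
Qed.

(** The first clause of [commute] holds for all boxes of [a, b]: indices before
    a are before all of [a, b], and an index after y with the color of a is
    after b by the choice of y as the last one. *)
Lemma rtrunc_universal a b :
  a <= b -> seg (a, b) `<=` S ->
  exists y, [/\ universal_box a b (a, y), seg (a, y) = seg_rtrunc S i a b
    & forall t, a <= t <= b -> i t = i a -> t <= y].
Proof.
move=> ab abS.
have [||y [aby iy] maxy] := @int_max [set t | a <= t <= b /\ i t = i a] b.
- by exists a; split=> //=; lia.
- by move=> t [/andP[]].
exists y; split; last by move=> t abt it; exact: maxy.
- split.
  + split=> /=; [by lia | | by rewrite iy].
    by move=> z; rewrite segE /= => az; apply: abS; rewrite segE /=; lia.
  + by apply/subset_seg; lia.
  + move=> [d1 d2] /= d12 /(subset_seg _ _ d12) dab; apply/commuteE; left.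
    split=> //= t St; first by lia.
    move=> yt it; case: (ltP d2 t) => // td.
    have /maxy : a <= t <= b /\ i t = i a by split; [lia | rewrite it].
    by lia.
- have lastE : last_le S i b (i a) = y%:E%E.
    apply: emax_fin.
      by split=> //; [apply: abS; rewrite segE /= | lia].
    move=> t [St tb it]; case: (leP a t) => [at_|]; last by lia.
    by apply: maxy; split=> //; lia.
  by apply/seteqP; split=> z; rewrite segE /seg_rtrunc /= lastE !lee_fin.
Qed.

Lemma ltrunc_universal a b :
  a <= b -> seg (a, b) `<=` S ->
  exists x, [/\ universal_box a b (x, b), seg (x, b) = seg_ltrunc S i a b
    & forall t, a <= t <= b -> i t = i b -> x <= t].
Proof.
move=> ab abS.
have [||x [abx ix] minx] := @int_min [set t | a <= t <= b /\ i t = i b] a.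
- by exists b; split=> //=; lia.
- by move=> t [/andP[]].
exists x; split; last by move=> t abt it; exact: minx.
- split.
  + split=> /=; [by lia | | by rewrite ix].
    by move=> z; rewrite segE /= => az; apply: abS; rewrite segE /=; lia.
  + by apply/subset_seg; lia.
  + move=> [d1 d2] /= d12 /(subset_seg _ _ d12) dab; apply/commuteE; left.
    split=> //= t St; last by lia.
    move=> tx it; case: (ltP t d1) => // td.
    have /minx : a <= t <= b /\ i t = i b by split; [lia | rewrite it].
    by lia.
- have firstE : first_ge S i a (i b) = x%:E%E.
    apply: emin_fin.
      by split=> //; [apply: abS; rewrite segE /= | lia].
    move=> t [St ta it]; case: (leP t b) => [tb|]; last by lia.
    by apply: minx; split=> //; lia.
  by apply/seteqP; split=> z; rewrite segE /seg_ltrunc /= firstE !lee_fin.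
Qed.

(** * Removing the last box *)

(** Two boxes [a, y'] and [x', b] with y' < y and x < x' do not commute,
    since y and x are obstructions to the two clauses of [commute]. *)
Lemma unique_end_box a b x y F :
  S x -> S y -> a <= x -> y <= b -> i y = i a -> i x = i b ->
  (forall t, a <= t <= b -> i t = i a -> t <= y) ->
  (forall t, a <= t <= b -> i t = i b -> x <= t) ->
  commuting_family S i a b F ->
  (forall d, F d -> d <> (a, y) -> seg d `<=` seg (a + 1, b)) \/
  (forall d, F d -> d <> (x, b) -> seg d `<=` seg (a, b - 1)).
Proof.
move=> Sx Sy ax yb iy ix maxy minx [Fab Fcomm].
have [|/existsNP[[c1 c2] /not_implyP[Fc /not_implyP[ce cab]]]] :=
  pselect (forall d, F d -> d <> (a, y) -> seg d `<=` seg (a + 1, b)).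
  by left.
right=> -[d1 d2] Fd df; apply: contrapT => dab.
have [[/= c12 _ ic] /(subset_seg _ _ c12) [ac cb]] := Fab _ Fc.
have [[/= d12 _ id_] /(subset_seg _ _ d12) [ad db]] := Fab _ Fd.
have Ec1 : c1 = a.
  by case: (eqVneq c1 a) => // ?; case: cab; apply/(subset_seg _ _ c12); lia.
have Ed2 : d2 = b.
  by case: (eqVneq d2 b) => // ?; case: dab; apply/(subset_seg _ _ d12); lia.
subst c1 d2.
have c2y : c2 < y.
  rewrite lt_neqAle maxy ?ic //; last by lia.
  by rewrite andbT; apply/eqP => c2y; apply: ce; rewrite c2y.
have xd1 : x < d1.
  rewrite lt_neqAle minx ?id_ //; last by lia.
  by rewrite andbT; apply/eqP => d1x; apply: df; rewrite d1x.
have cd : (a, c2) <> (d1, b) by case; lia.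
have /commuteE[[_ _ /= n]|[/= p _ _]] := Fcomm _ _ Fc Fd cd.
  by have := n y Sy c2y; rewrite iy ic => /(_ erefl); lia.
by have := p x Sx xd1; rewrite ix id_ => /(_ erefl); lia.
Qed.

(** One of the boxes [a, b} and {a, b] can be detached from F.  The remaining
    interval is [a + 1, b] in the first case and [a, b - 1] in the second; both
    have one element less than [a, b], so the left end a' determines which. *)
Lemma maximal_commuting_step a b F :
  a <= b -> seg (a, b) `<=` S -> maximal_commuting_family S i a b F ->
  exists e a', [/\ F e, ibox S i e,
    seg e = seg_rtrunc S i a b \/ seg e = seg_ltrunc S i a b,
    a <= a' <= a + 1
    & let b' := a' + (b - a) - 1 in
      seg (a', b') `|` seg e = seg (a, b) /\
      maximal_commuting_family S i a' b' (F `\ e)].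
Proof.
move=> ab abS mF.
have [y [uy Ey maxy]] := rtrunc_universal ab abS.
have [x [ux Ex minx]] := ltrunc_universal ab abS.
have [[/= ay ayS iy] /(subset_seg _ _ ay) [_ yb] _] := uy.
have [[/= xb xbS ix] /(subset_seg _ _ xb) [ax _] _] := ux.
have Sx : S x by apply: xbS; rewrite segE /=; lia.
have Sy : S y by apply: ayS; rewrite segE /=; lia.
have [Fe|Ff] :=
  unique_end_box Sx Sy ax yb (esym iy) ix maxy minx mF.1.
- exists (a, y), (a + 1); split.
  + exact: universal_mem uy mF.
  + by case: uy.
  + by left.
  + by lia.
  + have -> /= : a + 1 + (b - a) - 1 = b by lia.
    split.
      apply/seteqP; split=> z /=; rewrite /setU /= !segE /=; first by lia.
      by case: (ltP a z) => ? ?; [left | right]; lia.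
    apply: (maximal_setD1 _ _ uy) => //; first by lia.
    by move=> /(subset_seg _ _ ay); lia.
- exists (x, b), a; split.
  + exact: universal_mem ux mF.
  + by case: ux.
  + by right.
  + by lia.
  + have -> /= : a + (b - a) - 1 = b - 1 by lia.
    split.
      apply/seteqP; split=> z /=; rewrite /setU /= !segE /=; first by lia.
      by case: (ltP z b) => ? ?; [left | right]; lia.
    apply: (maximal_setD1 _ _ ux) => //; first by lia.
    by move=> /(subset_seg _ _ xb); lia.
Qed.

(** * Building the chain *)

Lemma envelopeS (c : nat -> int * int) n :
  envelope c n.+1 = envelope c n `|` seg (c n.+1).
Proof.
apply/seteqP; split=> z.
  move=> [j /= /andP[j1]]; rewrite leq_eqVlt => /orP[/eqP->|jn] cz; first by right.
  by left; exists j => //=; lia.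
by case=> [[j /= jn cz]|cz]; [exists j => //=; lia | exists n.+1 => //=; lia].
Qed.

Lemma eq_envelope (c c' : nat -> int * int) n :
  (forall k, (k <= n)%N -> c k = c' k) -> envelope c n = envelope c' n.
Proof.
by move=> cc'; apply: eq_bigcupr => k /= /andP[_ kn]; rewrite cc'.
Qed.

(** The induction starts from the empty interval, whose only family of boxes
    is empty; the bounds of the envelopes are given by their lengths so that
    cardinalities need not be carried along. *)
Lemma chain_of_maximal n a F :
  seg (a, a + n%:Z - 1) `<=` S ->
  maximal_commuting_family S i a (a + n%:Z - 1) F ->
  exists c : nat -> int * int,
    [/\ forall k, (1 <= k <= n)%N -> ibox S i (c k) /\
          exists2 x, envelope c k = seg (x, x + k%:Z - 1) &
            seg (c k) = seg_rtrunc S i x (x + k%:Z - 1) \/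
            seg (c k) = seg_ltrunc S i x (x + k%:Z - 1),
        envelope c n = seg (a, a + n%:Z - 1)
      & F = [set c k | k in [set k | (1 <= k <= n)%N]]].
Proof.
elim: n a F => [|n IH] a F abS mF.
  exists (fun=> (0, 0)); split; first by lia.
    apply/seteqP; split=> z; first by case=> j /=; lia.
    by rewrite segE /=; lia.
  apply/seteqP; split=> z; last by case=> j /=; lia.
  by case: z => z1 z2 /mF.1.1[[/= z12 _ _] /(subset_seg _ _ z12)]; lia.
set b := a + n.+1%:Z - 1 in abS mF *.
have ab : a <= b by rewrite /b; lia.
have [e [a' [Fe ibe eE aa' [Eab mF']]]] := maximal_commuting_step ab abS mF.
have Eb' : a' + (b - a) - 1 = a' + n%:Z - 1 by rewrite /b; lia.
rewrite {}Eb' in Eab mF'.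
have [|c [cP cenv cF]] := IH a' _ _ mF'.
  by apply: subset_trans abS; rewrite -Eab; exact: subsetUl.
pose c' k := if k == n.+1 then e else c k.
have c'n : c' n.+1 = e by rewrite /c' eqxx.
have c'c k : (k <= n)%N -> c' k = c k by rewrite /c'; case: eqP => // ->; lia.
have envc' k : (k <= n)%N -> envelope c' k = envelope c k.
  by move=> kn; apply: eq_envelope => j jk; apply: c'c; lia.
have envSn : envelope c' n.+1 = seg (a, b).
  by rewrite envelopeS c'n envc' // cenv.
exists c'; split=> //.
  move=> k /andP[k1]; rewrite leq_eqVlt => /orP[/eqP->|kn].
    by rewrite c'n; split=> //; exists a.
  by rewrite c'c // envc' //; apply: cP; lia.
apply/seteqP; split=> d.
  move=> Fd; have [->|de] := pselect (d = e).
    by exists n.+1 => //=; lia.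
  have : (F `\ e) d by [].
  by rewrite cF => -[k /= kn <-]; exists k; [lia | apply: c'c; lia].
move=> [k /= /andP[k1]]; rewrite leq_eqVlt => /orP[/eqP->|kn].
  by rewrite c'n => <-.
rewrite c'c // => <-.
have : (F `\ e) (c k) by rewrite cF; exists k => //=; lia.
by case.
Qed.

End Boxes.

Unset Implicit Arguments.

Theorem corollary2p10 (I : Type) (S : set int) (i : int -> I) (a b : int)
    (F : set (int * int)) :
  is_interval S ->
  a <= b ->
  seg (a, b) `<=` S ->
  maximal_commuting_family S i a b F ->
  exists (l : nat) (c : nat -> int * int),
    [/\ admissible_chain S i l c,
        envelope c l = seg (a, b) &
        F = [set c k | k in [set k | (1 <= k <= l)%N]]].
Proof.
move=> _ ab abS mF; pose l := `|(b - a + 1)%R|%N.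
have Eb : b = a + l%:Z - 1 by rewrite /l; lia.
rewrite Eb in abS mF *.
have [c [cP cenv cF]] := chain_of_maximal abS mF.
exists l, c; split=> //; split; first by rewrite /l; lia.
move=> k /cP[ibc [x Ex cE]]; split=> //.
by exists x, (x + k%:Z - 1); split=> //; rewrite Ex; exact: seg_card.
Qed.
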